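(* Let ${}_2S_{a,b,c}$ be a cubic Sklyanin algebra and let ${}_2c_{a,b,c}$ be its normal element of degree 4 generating the intersection of the annihilators of its point modules. Then $\mathbb{C}\,{}_2c_{a,b,c}$ is isomorphic to the trivial representation of $H_2$.
   Context: All algebras are over $\mathbb{C}$. For $[a:b:c]\in\mathbb{P}^2$ the cubic Sklyanin algebra ${}_2S_{a,b,c}$ is the quotient of $\mathbb{C}\langle x,y\rangle$ (generators in degree 1) by $a(y^2x+xy^2)+byxy+cx^3$ and $a(x^2y+yx^2)+bxyx+cy^3$, under the condition that ${}_2E_{a,b,c}=\mathbf{V}\big((b^2-c^2)x_0y_0x_1y_1+ab(x_0^2y_1^2+y_0^2x_1^2)-ac(x_0^2x_1^2+y_0^2y_1^2)\big)\subset\mathbb{P}^1\times\mathbb{P}^1$ is a smooth curve of genus 1. $H_2=\langle e_1,e_2:e_1^2=e_2^2=[e_1,e_2]^2=1,\ [e_1,e_2]\text{ central}\rangle$ acts on ${}_2S_{a,b,c}$ by graded automorphisms via $e_1\cdot x=y$, $e_1\cdot y=x$, $e_2\cdot x=x$, $e_2\cdot y=-y$. A point module is a cyclic graded right module with Hilbert series $(1-t)^{-1}$; the point modules of ${}_2S_{a,b,c}$ are parametrized by ${}_2E_{a,b,c}$: the point module $M_p$ of $p=(p_0,p_1)\in{}_2E_{a,b,c}$ is $\bigoplus_{i\ge0}\mathbb{C}m_i$ with $m_ix=x_im_{i+1}$, $m_iy=y_im_{i+1}$, $[x_i:y_i]=p_i$, where the points $p_i\in\mathbb{P}^1$, $i\ge2$,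 are determined by the vanishing of the multilinearized relations on all $(p_i,p_{i+1},p_{i+2})$. By Artin, Tate and Van den Bergh, $\bigcap_{p\in{}_2E_{a,b,c}}\mathrm{Ann}(M_p)$ is generated by a (nonzero) normal element of degree 4, unique up to scalar, denoted ${}_2c_{a,b,c}$. *)

(* Defs.v *)
From HB Require Import structures.
From mathcomp Require Import all_boot all_order all_algebra all_fingroup.
From mathcomp Require Import generic_quotient ring_quotient.
From mathcomp Require Import finmap boolp reals complex monalg mpoly.

Set Implicit Arguments.
Unset Strict Implicit.
Unset Printing Implicit Defensive.

Import GRing.Theory.
Local Open Scope ring_scope.
Local Open Scope quotient_scope.

Definition two_sided_ideal (A : nzRingType) (P : A -> Prop) (u : A) : Prop :=
  exists2 s : seq (A * A * A),
    forall t, t \in s -> P t.1.2 & u = \sum_(t <- s) t.1.1 * t.1.2 * t.2.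

Definition normal_element (A : nzRingType) (u : A) : Prop :=
  (forall s, exists t, u * s = t * u) /\ (forall s, exists t, s * u = u * t).

Section IdealTheory.
Variables (A : nzRingType) (P : A -> Prop).

Lemma two_sided_ideal_gen u : P u -> two_sided_ideal P u.
Proof.
move=> Pu; exists [:: (1, u, 1)]; last by rewrite big_seq1 mul1r mulr1.
by move=> t; rewrite inE => /eqP ->.
Qed.

Lemma two_sided_idealD u v :
  two_sided_ideal P u -> two_sided_ideal P v -> two_sided_ideal P (u + v).
Proof.
move=> [s Ps ->] [t Pt ->]; exists (s ++ t); last by rewrite big_cat.
by move=> w; rewrite mem_cat => /orP[/Ps|/Pt].
Qed.

Lemma two_sided_idealM w z u :
  two_sided_ideal P u -> two_sided_ideal P (w * u * z).
Proof.
move=> [s Ps ->]; exists [seq (w * t.1.1, t.1.2, t.2 * z) | t <- s].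
  by move=> _ /mapP[t /Ps ? ->].
rewrite big_map mulr_sumr mulr_suml; apply: eq_bigr => t _ /=.
by rewrite !mulrA.
Qed.

Lemma two_sided_ideal_zmod_closed :
  zmod_closed (fun u => `[< two_sided_ideal P u >]).
Proof.
split=> [|u v /asboolP Iu /asboolP Iv]; apply/asboolP.
  by exists [::]; rewrite ?big_nil.
apply: two_sided_idealD => //.
by have := two_sided_idealM (-1) 1 Iv; rewrite mulN1r mulr1.
Qed.

End IdealTheory.

(* The free algebra K<x, y>: the monoid algebra of words in two letters, with  *)
(* false standing for x and true for y.                                        *)
Section FreeAlgebra.
Variable K : fieldType.

Definition freeAlg : Type := {malg K[{fmonom bool}]}.

HB.instance Definition _ := GRing.Lalgebra.on freeAlg.

Lemma freeAlg_scaleAr (k : K) (u v : freeAlg) : k *: (u * v) = u * (k *: v).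
Proof.
apply/malgP => w; rewrite monalg.mcoeffZ monalg.mcoeffMl.
rewrite (monalg.mcoeffMlw w (finmap.fsubset_refl _) (monalg.msuppZ_le k v)).
rewrite mulr_sumr; apply: eq_bigr => w1 _; rewrite mulr_sumr.
by apply: eq_bigr => w2 _; rewrite monalg.mcoeffZ mulrnAr mulrCA.
Qed.

HB.instance Definition _ := GRing.Lalgebra_isAlgebra.Build K freeAlg
  freeAlg_scaleAr.

End FreeAlgebra.

Section Relations.
Variables (K : fieldType) (a b c : K) (A : algType K).

Definition cubic_rel (x y : A) : A :=
  a *: (y ^+ 2 * x + x * y ^+ 2) + b *: (y * x * y) + c *: x ^+ 3.

Lemma cubic_rel_eq0 (f : A -> K) (x y : A) :
    {morph f : u v / u + v} -> {morph f : u v / u * v} ->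
    (forall k u, f (k *: u) = k * f u) -> f x = 0 -> f y = 0 ->
  f (cubic_rel x y) = 0.
Proof.
move=> fD fM fZ fx fy; rewrite /cubic_rel !fD !fZ !fD !exprS !expr0 !fM fx fy.
by rewrite !(mulr0, mul0r, addr0).
Qed.

Lemma rmorph_cubic_rel (B : algType K) (f : {lrmorphism A -> B}) (x y : A) :
  f (cubic_rel x y) =
  a *: (f y ^+ 2 * f x + f x * f y ^+ 2) + b *: (f y * f x * f y)
  + c *: f x ^+ 3.
Proof. by rewrite scalerDr !(linearD, linearZ) /= !rmorphM -scalerDr. Qed.

End Relations.

Section Sklyanin.
Variables (K : fieldType) (a b c : K).
Implicit Types u v : freeAlg K.

Local Notation x := (mkmalgU (fmu false) 1 : freeAlg K).
Local Notation y := (mkmalgU (fmu true) 1 : freeAlg K).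

Definition sklyanin_ideal : {pred freeAlg K} := fun u =>
  `[< two_sided_ideal
    (fun r => r = cubic_rel a b c x y \/ r = cubic_rel a b c y x) u >].

HB.instance Definition _ := GRing.isZmodClosed.Build (freeAlg K) sklyanin_ideal
  (two_sided_ideal_zmod_closed _).

Lemma sklyanin_idealM u v w :
  v \in sklyanin_ideal -> u * v * w \in sklyanin_ideal.
Proof. by move=> /asboolP Iv; apply/asboolP/two_sided_idealM. Qed.

Lemma sklyanin_ideal1 : 1 \notin sklyanin_ideal.
Proof.
have [aug [aug1 augD augM augZ augU]] : exists aug : freeAlg K -> K,
    [/\ aug 1 = 1, {morph aug : u v / u + v}, {morph aug : u v / u * v},
        forall k u, aug (k *: u) = k * aug u
      & forall i, aug (mkmalgU (fmu i) 1) = 0].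
  exists (monalg.mcoeff (mone : {fmonom bool})); split.
  - exact: rmorph1.
  - exact: raddfD.
  - exact: rmorphM.
  - by move=> k u; rewrite monalg.mcoeffZ.
  - by move=> i; rewrite monalg.mcoeffU fm1_eq1.
have aug0 : aug 0 = 0 by apply: (addrI (aug 0)); rewrite -augD !addr0.
apply/negP => /asboolP [s rs] /(congr1 aug).
rewrite aug1 (big_morph aug augD aug0) big1_seq => [/eqP|t /andP[_ /rs tr]].
  by rewrite oner_eq0.
rewrite !augM; suff -> : aug t.1.2 = 0 by rewrite mulr0 mul0r.
by case: tr => ->; apply: cubic_rel_eq0.
Qed.

Definition sklyanin : Type := Quotient.quot sklyanin_ideal.

HB.instance Definition _ := GRing.Zmodule.on sklyanin.
HB.instance Definition _ := EqQuotient.on sklyanin.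
HB.instance Definition _ := ZmodQuotient.on sklyanin.

Definition sklyanin_one : sklyanin := lift_cst sklyanin 1.
Definition sklyanin_mul := lift_op2 sklyanin *%R.
Definition sklyanin_scale (k : K) := lift_op1 sklyanin ( *:%R k).

Lemma sklyanin_piP u v :
  reflect (\pi_sklyanin u = \pi_sklyanin v) (u - v \in sklyanin_ideal).
Proof. by rewrite Quotient.idealrBE; apply: eqP. Qed.

Canonical pi_sklyanin_one := PiConst sklyanin_one.

Lemma pi_sklyanin_mulE : {morph \pi_sklyanin : u v / u * v >-> sklyanin_mul u v}.
Proof.
move=> u v; unlock sklyanin_mul; apply/sklyanin_piP.
set u' := repr _; set v' := repr _.
have Iu : u - u' \in sklyanin_ideal by apply/sklyanin_piP; rewrite reprK.
have Iv : v - v' \in sklyanin_ideal by apply/sklyanin_piP; rewrite reprK.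
rewrite -[u * v](subrK (u' * v)) -addrA -mulrBl -mulrBr rpredD //.
  by rewrite -[_ * v]mul1r mulrA sklyanin_idealM.
by rewrite -[u' * _]mulr1 sklyanin_idealM.
Qed.
Canonical pi_sklyanin_mul := PiMorph2 pi_sklyanin_mulE.

Lemma pi_sklyanin_scaleE k :
  {morph \pi_sklyanin : u / k *: u >-> sklyanin_scale k u}.
Proof.
move=> u; unlock sklyanin_scale; apply/sklyanin_piP.
set u' := repr _; rewrite -scalerBr.
have Iu : u - u' \in sklyanin_ideal by apply/sklyanin_piP; rewrite reprK.
by rewrite -[_ - _]mul1r scalerAl -[_ * _]mulr1 sklyanin_idealM.
Qed.
Canonical pi_sklyanin_scale k := PiMorph1 (pi_sklyanin_scaleE k).

Lemma sklyanin_mulA : associative sklyanin_mul.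
Proof. by elim/quotW=> s; elim/quotW=> t; elim/quotW=> r; rewrite !piE mulrA. Qed.

Lemma sklyanin_mul1l : left_id sklyanin_one sklyanin_mul.
Proof. by elim/quotW=> s; rewrite !piE mul1r. Qed.

Lemma sklyanin_mul1r : right_id sklyanin_one sklyanin_mul.
Proof. by elim/quotW=> s; rewrite !piE mulr1. Qed.

Lemma sklyanin_mulDl : left_distributive sklyanin_mul +%R.
Proof. by elim/quotW=> s; elim/quotW=> t; elim/quotW=> r; rewrite !piE mulrDl. Qed.

Lemma sklyanin_mulDr : right_distributive sklyanin_mul +%R.
Proof. by elim/quotW=> s; elim/quotW=> t; elim/quotW=> r; rewrite !piE mulrDr. Qed.

Lemma sklyanin_one_neq0 : sklyanin_one != 0.
Proof.
by rewrite piE Quotient.equivE subr0 sklyanin_ideal1.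
Qed.

HB.instance Definition _ := GRing.Zmodule_isNzRing.Build sklyanin
  sklyanin_mulA sklyanin_mul1l sklyanin_mul1r sklyanin_mulDl sklyanin_mulDr
  sklyanin_one_neq0.

Lemma sklyanin_scaleA k l (s : sklyanin) :
  sklyanin_scale k (sklyanin_scale l s) = sklyanin_scale (k * l) s.
Proof. by elim/quotW: s => s; rewrite !piE scalerA. Qed.

Lemma sklyanin_scale1 : left_id 1 sklyanin_scale.
Proof. by elim/quotW=> s; rewrite !piE scale1r. Qed.

Lemma sklyanin_scaleDr : right_distributive sklyanin_scale +%R.
Proof. by move=> k; elim/quotW=> s; elim/quotW=> t; rewrite !piE scalerDr. Qed.

Lemma sklyanin_scaleDl (s : sklyanin) :
  {morph sklyanin_scale^~ s : k l / k + l >-> k + l}.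
Proof. by move=> k l; elim/quotW: s => s; rewrite !piE scalerDl. Qed.

HB.instance Definition _ := GRing.Zmodule_isLmodule.Build K sklyanin
  sklyanin_scaleA sklyanin_scale1 sklyanin_scaleDr sklyanin_scaleDl.

Lemma sklyanin_scaleAl k (s t : sklyanin) : k *: (s * t) = (k *: s) * t.
Proof.
elim/quotW: s => s; elim/quotW: t => t.
by rewrite /GRing.scale /GRing.mul /= !piE scalerAl.
Qed.

HB.instance Definition _ := GRing.Lmodule_isLalgebra.Build K sklyanin
  sklyanin_scaleAl.

Lemma sklyanin_scaleAr k (s t : sklyanin) : k *: (s * t) = s * (k *: t).
Proof.
elim/quotW: s => s; elim/quotW: t => t.
by rewrite /GRing.scale /GRing.mul /= !piE scalerAr.
Qed.

HB.instance Definition _ := GRing.Lalgebra_isAlgebra.Build K sklyanin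
  sklyanin_scaleAr.

Definition sklyanin_pi (u : freeAlg K) : sklyanin := \pi_sklyanin u.

Lemma sklyanin_pi_linear : linear sklyanin_pi.
Proof. by move=> k u v; rewrite /sklyanin_pi /GRing.scale /= !piE. Qed.

HB.instance Definition _ := GRing.isLinear.Build K (freeAlg K) sklyanin _
  sklyanin_pi sklyanin_pi_linear.

Lemma sklyanin_pi_monoid : monoid_morphism sklyanin_pi.
Proof.
by split=> [|u v]; rewrite /sklyanin_pi /GRing.one /GRing.mul /= !piE.
Qed.

HB.instance Definition _ := GRing.isMonoidMorphism.Build (freeAlg K) sklyanin
  sklyanin_pi sklyanin_pi_monoid.

Lemma sklyanin_pi_surj (s : sklyanin) : exists u, s = sklyanin_pi u.
Proof. by exists (repr s); rewrite /sklyanin_pi reprK. Qed.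

Lemma sklyanin_pi_eq0 u :
  sklyanin_pi u = 0 <->
  two_sided_ideal
    (fun r => r = cubic_rel a b c x y \/ r = cubic_rel a b c y x) u.
Proof.
rewrite -(raddf0 sklyanin_pi); split=> [/sklyanin_piP|Iu].
  by rewrite subr0 => /asboolP.
by apply/sklyanin_piP; rewrite subr0; apply/asboolP.
Qed.

Definition skx : sklyanin := sklyanin_pi x.
Definition sky : sklyanin := sklyanin_pi y.

Lemma sklyanin_relations :
  cubic_rel a b c skx sky = 0 /\ cubic_rel a b c sky skx = 0.
Proof.
by split; rewrite /cubic_rel -rmorph_cubic_rel sklyanin_pi_eq0;
  apply: two_sided_ideal_gen; [left|right].
Qed.

Definition sklyanin_homog (d : nat) (s : sklyanin) : Prop :=
  exists2 u : freeAlg K,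
    forall w : {fmonom bool}, w \in monalg.msupp u -> fdeg w = d & s = sklyanin_pi u.

End Sklyanin.

(* Bihomogeneous forms on P^1 x P^1, as polynomials in the coordinates         *)
(* ([x0 : y0], [x1 : y1]) = (X_0, X_1, X_2, X_3); a point of P^1 is given by a *)
(* nonzero pair of homogeneous coordinates.                                    *)
Section BihomogeneousCurves.
Variable K : fieldType.
Implicit Types (f g : mpoly 4 K) (p : K * K).

Definition ix0 : 'I_4 := @Ordinal 4 0 isT.
Definition iy0 : 'I_4 := @Ordinal 4 1 isT.
Definition ix1 : 'I_4 := @Ordinal 4 2 isT.
Definition iy1 : 'I_4 := @Ordinal 4 3 isT.

Definition bihomog (d e : nat) f : bool :=
  all (fun m : multinom 4 => (m ix0 + m iy0 == d)%N && (m ix1 + m iy1 == e)%N)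
      (msupp f).

Definition bieval f (p0 p1 : K * K) : K :=
  f.@[tnth [tuple p0.1; p0.2; p1.1; p1.2]].

Definition on_curve f (p0 p1 : K * K) : Prop :=
  [/\ p0 != 0, p1 != 0 & bieval f p0 p1 = 0].

(* By Euler's relations, the vanishing of the four partial derivatives at a    *)
(* point of the curve amounts to that of the two derivatives in an affine      *)
(* chart P^1 x P^1 around it.                                                  *)
Definition smooth_curve f : Prop :=
  forall p0 p1, on_curve f p0 p1 -> exists i, bieval f^`M(i) p0 p1 != 0.

Definition irreducible_form f : Prop :=
  (forall k, f != k%:MP) /\
  forall g h, f = g * h -> (exists k, g = k%:MP) \/ (exists k, h = k%:MP).

(* The component of bidegree (n, n) of the coordinate ring K[x0,y0,x1,y1]/(f)  *)
(* has dimension k.                                                            *)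
Definition hilbert_dim f (n k : nat) : Prop :=
  exists B : 'I_k -> mpoly 4 K, (forall i, bihomog n n (B i)) /\
    forall g, bihomog n n g ->
      exists! l : {ffun 'I_k -> K}, exists q, g = \sum_i l i *: B i + q * f.

(* The Hilbert polynomial of the curve f = 0, embedded in P^3 by O(1, 1), is   *)
(* d n + 1 - g, with g the arithmetic genus (the genus, for a smooth curve).   *)
Definition curve_genus f (g : nat) : Prop :=
  exists d N, (0 < d)%N /\ forall n, (N <= n)%N ->
    exists2 k, hilbert_dim f n k & (k + g = d * n + 1)%N.

(* Irreducibility and genus 1 follow from smoothness in bidegree (2, 2).       *)
Definition smooth_curve_of_genus f (g : nat) : Prop :=
  [/\ irreducible_form f, smooth_curve f & curve_genus f g].

End BihomogeneousCurves.

Section CubicSklyanin.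
Variables (K : fieldType) (a b c : K).
Local Notation S := (sklyanin a b c).

Definition E_form : mpoly 4 K :=
  let: (x0, y0, x1, y1) := ('X_ix0, 'X_iy0, 'X_ix1, 'X_iy1) in
  (b ^+ 2 - c ^+ 2) *: (x0 * y0 * x1 * y1)
  + (a * b) *: (x0 ^+ 2 * y1 ^+ 2 + y0 ^+ 2 * x1 ^+ 2)
  - (a * c) *: (x0 ^+ 2 * x1 ^+ 2 + y0 ^+ 2 * y1 ^+ 2).

Definition cubic_sklyanin : Prop :=
  (a, b, c) != 0 /\ smooth_curve_of_genus E_form 1.

Definition multilin_rel1 (p q r : K * K) : K :=
  a * (p.2 * q.2 * r.1 + p.1 * q.2 * r.2) + b * (p.2 * q.1 * r.2)
  + c * (p.1 * q.1 * r.1).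
Definition multilin_rel2 (p q r : K * K) : K :=
  a * (p.1 * q.1 * r.2 + p.2 * q.1 * r.1) + b * (p.1 * q.2 * r.1)
  + c * (p.2 * q.2 * r.2).

(* Homogeneous coordinates of the sequence p_0, p_1, p_2, ... attached to a    *)
(* point (p_0, p_1) of the curve E.                                            *)
Definition point_sequence (p : nat -> K * K) : Prop :=
  [/\ on_curve E_form (p 0) (p 1), forall i, p i != 0
    & forall i, multilin_rel1 (p i) (p i.+1) (p i.+2) = 0 /\
                multilin_rel2 (p i) (p i.+1) (p i.+2) = 0].

Definition right_module (A : algType K) (V : lmodType K) (act : V -> A -> V) :=
  [/\ forall s, linear (act^~ s), forall v, linear (act v),
      forall v, act v 1 = v & forall v s t, act v (s * t) = act (act v s) t].

(* The right module structure of M_p on the sum of the K m_i, realized as      *)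
(* {poly K} with m_i = 'X^i.                                                   *)
Definition point_module (p : nat -> K * K) (act : {poly K} -> S -> {poly K}) :=
  right_module act /\
  forall i, act 'X^i (skx a b c) = (p i).1 *: 'X^(i.+1) /\
            act 'X^i (sky a b c) = (p i).2 *: 'X^(i.+1).

(* s lies in the intersection of the annihilators of the M_p, p in E.          *)
Definition annihilates_point_modules (s : S) : Prop :=
  forall p act, point_sequence p -> point_module p act ->
  forall v, act v s = 0.

Definition point_annihilator_generator (u : S) : Prop :=
  [/\ u != 0, sklyanin_homog 4 u, normal_element u
    & forall s, annihilates_point_modules s <->
                two_sided_ideal (fun r => r = u) s].

End CubicSklyanin.

(* \isog Grp compares H with the largest finite quotient of the presented      *)
(* group; as the latter has order 8, H is the presented group itself, and      *)
(* e1, e2 are its generators since they generate H and satisfy the relations.  *)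
Definition heisenberg2 (H : finGroupType) (e1 e2 : H) : Prop :=
  [/\ [set: H] = <<[set e1; e2]>>%g,
      (e1 ^+ 2 = 1 /\ e2 ^+ 2 = 1 /\ [~ e1, e2] ^+ 2 = 1)%g,
      (commute [~ e1, e2] e1 /\ commute [~ e1, e2] e2)%g
    & ([set: H] \isog Grp (x : y : x ^+ 2 = y ^+ 2 = 1, [~ x, y] ^+ 2,
                             [~ x, y, x], [~ x, y, y]))%g].

Section HeisenbergAction.
Variables (K : fieldType) (a b c : K) (H : finGroupType).
Local Notation S := (sklyanin a b c).
Local Notation x := (skx a b c).
Local Notation y := (sky a b c).

Definition heisenberg_action (e1 e2 : H) (rho : H -> {lrmorphism S -> S}) :=
  [/\ forall s, rho 1%g s = s,
      forall g h s, rho (g * h)%g s = rho g (rho h s),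
      forall g d s, sklyanin_homog d s -> sklyanin_homog d (rho g s),
      rho e1 x = y /\ rho e1 y = x
    & rho e2 x = x /\ rho e2 y = - y].

(* phi is an H-equivariant linear isomorphism from K, on which H acts          *)
(* trivially, onto the line K u.                                               *)
Definition line_is_trivial_rep (rho : H -> {lrmorphism S -> S}) (u : S) : Prop :=
  exists phi : {linear K^o -> S},
    [/\ injective phi,
        forall s, (exists k, s = phi k) <-> (exists k, s = k *: u)
      & forall g k, rho g (phi k) = phi k].

End HeisenbergAction.

(* Main.v *)
From HB Require Import structures.
Require Import Defs.
From mathcomp Require Import all_boot all_order all_algebra all_fingroup.
From mathcomp Require Import reals complex.
From mathcomp Require Import finmap monalg mpoly ring.

(* An explicit element g of degree 4, visibly invariant under x <-> y and
   y -> - y, kills every point module: on consecutive points p, q, r, s of a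
   point sequence, p and s span the left and right kernels of a rank one 2 x 2
   matrix with entries of bidegree (1, 1) in (q, r), so the evaluation of g is a
   multiple of the determinant of that matrix, i.e. of the equation of the curve
   at (q, r).  Hence g lies in the ideal generated by c2, and comparing degrees
   g = k c2.  Smoothness of E forces a, b, c and b^2 - c^2 to be nonzero, and
   then invariant functionals on the words of length 4 that vanish on the
   relations detect that g is nonzero in the algebra.  So c2 is invariant. *)

Set Implicit Arguments.
Unset Strict Implicit.
Unset Printing Implicit Defensive.
Import GRing.Theory Num.Theory.
Local Open Scope ring_scope.

(** * Smoothness of the curve constrains the parameters *)

Section Curve.
Variables (K : numClosedFieldType) (a b c : K).

Lemma meval_mderivU n (v : 'I_n -> K) (i j : 'I_n) :
  meval v (mderiv i 'X_j) = (j == i)%:R.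
Proof.
(* For [j] distinct from [i] the coefficient is 0, so the truncated exponent of the derived monomial
   is irrelevant. *)
rewrite mderivX mnm1E mevalZ; case: eqP => [->|_]; last by rewrite mul0r.
by rewrite -[X in (X - _)%MM]add0m addmK mpolyX0 meval1 mulr1.
Qed.

(** The last four equations are the partial derivatives of [E_form] at the point, expanded so that a
    concrete singular point can be refuted by [ring]. *)
Lemma singular_E_form (x0 y0 x1 y1 : K) :
    smooth_curve (E_form a b c) -> (x0, y0) != 0 -> (x1, y1) != 0 ->
    (b ^+ 2 - c ^+ 2) * (x0 * y0 * x1 * y1)
      + a * b * (x0 ^+ 2 * y1 ^+ 2 + y0 ^+ 2 * x1 ^+ 2)
      - a * c * (x0 ^+ 2 * x1 ^+ 2 + y0 ^+ 2 * y1 ^+ 2) = 0 ->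
    (b ^+ 2 - c ^+ 2) * (y0 * x1 * y1)
      + 2 * (a * b) * (x0 * y1 ^+ 2) - 2 * (a * c) * (x0 * x1 ^+ 2) = 0 ->
    (b ^+ 2 - c ^+ 2) * (x0 * x1 * y1)
      + 2 * (a * b) * (y0 * x1 ^+ 2) - 2 * (a * c) * (y0 * y1 ^+ 2) = 0 ->
    (b ^+ 2 - c ^+ 2) * (x0 * y0 * y1)
      + 2 * (a * b) * (y0 ^+ 2 * x1) - 2 * (a * c) * (x0 ^+ 2 * x1) = 0 ->
    (b ^+ 2 - c ^+ 2) * (x0 * y0 * x1)
      + 2 * (a * b) * (x0 ^+ 2 * y1) - 2 * (a * c) * (y0 ^+ 2 * y1) = 0 ->
  False.
Proof.
move=> smooth p0 p1 E Ex0 Ey0 Ex1 Ey1.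
have [|i] := smooth (x0, y0) (x1, y1).
  split=> //; rewrite /bieval /E_form !(mevalB, mevalD, mevalZ, mevalM, mevalXU).
  exact: E.
rewrite /bieval /E_form !expr2 !(mderivB, mderivD, mderivZ, mderivM).
rewrite !(mevalB, mevalD, mevalZ, mevalM, mevalXU, meval_mderivU).
have -> : tnth [tuple x0; y0; x1; y1] ix0 = x0 by [].
have -> : tnth [tuple x0; y0; x1; y1] iy0 = y0 by [].
have -> : tnth [tuple x0; y0; x1; y1] ix1 = x1 by [].
have -> : tnth [tuple x0; y0; x1; y1] iy1 = y1 by [].
case: i => [[|[|[|[|//]]]] lti] /negP; apply; apply/eqP.
- by rewrite /= -Ex0; ring.
- by rewrite /= -Ey0; ring.
- by rewrite /= -Ex1; ring.
- by rewrite /= -Ey1; ring.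
Qed.

Lemma smooth_E_form_coefs : smooth_curve (E_form a b c) ->
  [/\ a != 0, b != 0, c != 0 & b ^+ 2 != c ^+ 2].
Proof.
move=> smooth.
have n0 (u v : K) : (u == 1) || (v == 1) -> (u, v) != 0.
  by move=> uv; apply/eqP => -[u0 v0]; rewrite u0 v0 !(eq_sym 0) oner_eq0 in uv.
have sing x0 y0 x1 y1 := @singular_E_form x0 y0 x1 y1 smooth.
split.
(* When [a], [b] or [c] is 0, every remaining monomial vanishes to order two at a point with
   coordinates 0 and 1. *)
- apply/eqP => a0; apply: (sing 0 1 0 1);
    rewrite ?n0 ?eqxx ?orbT // a0; ring.
- apply/eqP => b0; apply: (sing 0 1 1 0);
    rewrite ?n0 ?eqxx ?orbT // b0; ring.
- apply/eqP => c0; apply: (sing 0 1 0 1);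
    rewrite ?n0 ?eqxx ?orbT // c0; ring.
(* For [b = c] the form is - a b (x0^2 - y0^2)(x1^2 - y1^2), for [b = - c] it is a b (x0^2 +
   y0^2)(x1^2 + y1^2); both are singular where the two factors vanish. *)
- rewrite eqf_sqr; apply/negP => /orP[] /eqP bc.
    by apply: (sing 1 1 1 1); rewrite ?n0 ?eqxx ?orbT // bc; ring.
  have i2 := sqrCi K.
  by apply: (sing 'i 1 1 'i); rewrite ?n0 ?eqxx ?orbT // bc; ring: i2.
Qed.

End Curve.

(** * Vanishing of the quartic form along point sequences *)

Section PointModule.
Variables (K : fieldType) (a b c : K).

(** Multilinearization of the element [quartic] below: the scalar by which it sends m_i to m_(i+4)
    when [p], [q], [r], [s] are p_i, ..., p_(i+3). *)
Definition quartic_form (p q r s : K * K) : K :=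
  c * (b ^+ 2 - a ^+ 2) * (p.1 * q.1 * r.1 * s.1 + p.2 * q.2 * r.2 * s.2)
  + a * (a ^+ 2 - c ^+ 2) * (p.1 * q.1 * r.2 * s.2 + p.2 * q.2 * r.1 * s.1)
  + b * (c ^+ 2 - a ^+ 2) * (p.1 * q.2 * r.1 * s.2 + p.2 * q.1 * r.2 * s.1)
  + a * (a ^+ 2 - b ^+ 2) * (p.1 * q.2 * r.2 * s.1 + p.2 * q.1 * r.1 * s.2).

Lemma kernel_line (u v x y : K) : u != 0 -> x * u + y * v = 0 ->
  exists k, x = k * v /\ y = - (k * u).
Proof.
move=> u0 /(canRL (addrK _)); rewrite sub0r => xu; exists (- y / u).
by split; [apply: (mulIf u0); rewrite xu | ]; field.
Qed.

Lemma quartic_form_eq0 (p q r s : K * K) :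
    a != 0 -> b != 0 -> c != 0 -> b ^+ 2 != c ^+ 2 ->
    p != 0 -> q != 0 -> r != 0 ->
    multilin_rel1 a b c p q r = 0 -> multilin_rel2 a b c p q r = 0 ->
    multilin_rel1 a b c q r s = 0 -> multilin_rel2 a b c q r s = 0 ->
  quartic_form p q r s = 0.
Proof.
case: p q r s => [p1 p2] [q1 q2] [r1 r2] [s1 s2].
rewrite /multilin_rel1 /multilin_rel2 /quartic_form /=.
move=> a0 b0 c0 bc p0 q0 r0 rp1 rp2 rs1 rs2.
(* Let M have rows (A1, A2) and (B1, B2). The relations at (p, q, r) say p M = 0, those at (q, r, s)
   say M s = 0. *)
pose A1 := a * (q2 * r2) + c * (q1 * r1).
pose B1 := a * (q2 * r1) + b * (q1 * r2).
pose A2 := a * (q1 * r2) + b * (q2 * r1).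
pose B2 := a * (q1 * r1) + c * (q2 * r2).
have {}rp1 : p1 * A1 + p2 * B1 = 0 by rewrite -rp1 /A1 /B1; ring.
have {}rp2 : p1 * A2 + p2 * B2 = 0 by rewrite -rp2 /A2 /B2; ring.
have {}rs1 : s1 * A1 + s2 * A2 = 0 by rewrite -rs1 /A1 /A2; ring.
have {}rs2 : s1 * B1 + s2 * B2 = 0 by rewrite -rs2 /B1 /B2; ring.
have n0 (u v : K) : (u, v) != 0 -> (u == 0) && (v == 0) = false.
  by move=> uv; apply/negP => /andP[/eqP u0 /eqP v0]; rewrite u0 v0 eqxx in uv.
(* M has the nonzero left kernel vector p. Up to sign, its determinant is the equation of E at (q,
   r). *)
have det : A1 * B2 - B1 * A2 = 0.
  have d1 : p1 * (A1 * B2 - B1 * A2) = 0.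
    transitivity (B2 * (p1 * A1 + p2 * B1) - B1 * (p1 * A2 + p2 * B2)).
      by ring.
    by rewrite rp1 rp2 !mulr0 subr0.
  have d2 : p2 * (A1 * B2 - B1 * A2) = 0.
    transitivity (A1 * (p1 * A2 + p2 * B2) - A2 * (p1 * A1 + p2 * B1)).
      by ring.
    by rewrite rp1 rp2 !mulr0 subr0.
  apply/eqP; move: (n0 _ _ p0); apply: contraFT => d0.
  by move/eqP: d1; move/eqP: d2; rewrite !mulf_eq0 (negPf d0) !orbF => -> ->.
(* A nonzero entry of M determines p up to a scalar through its column and s through its row; after
   substitution the form is a multiple of the determinant. The next three cases are alike. *)
have [A10|A10] := eqVneq A1 0; last first.
  have [k [-> ->]] := kernel_line A10 rp1.
  have [l [-> ->]] := kernel_line A10 rs1.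
  transitivity (- (k * l * (c * (b ^+ 2 - a ^+ 2) * (q1 * r1)
                            + a * (a ^+ 2 - b ^+ 2) * (q2 * r2)))
                * (A1 * B2 - B1 * A2)); last by rewrite det mulr0.
  by rewrite /A1 /B1 /A2 /B2; ring.
have [B10|B10] := eqVneq B1 0; last first.
  have [k [-> ->]] := kernel_line B10 (etrans (addrC _ _) rp1).
  have [l [-> ->]] := kernel_line B10 rs2.
  transitivity (k * l * (a * (a ^+ 2 - c ^+ 2) * (q2 * r1)
                         + b * (c ^+ 2 - a ^+ 2) * (q1 * r2))
                * (A1 * B2 - B1 * A2)); last by rewrite det mulr0.
  by rewrite /A1 /B1 /A2 /B2; ring.
have [A20|A20] := eqVneq A2 0; last first.
  have [k [-> ->]] := kernel_line A20 rp2.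
  have [l [-> ->]] := kernel_line A20 (etrans (addrC _ _) rs1).
  transitivity (k * l * (a * (a ^+ 2 - c ^+ 2) * (q1 * r2)
                         + b * (c ^+ 2 - a ^+ 2) * (q2 * r1))
                * (A1 * B2 - B1 * A2)); last by rewrite det mulr0.
  by rewrite /A1 /B1 /A2 /B2; ring.
have [B20|B20] := eqVneq B2 0; last first.
  have [k [-> ->]] := kernel_line B20 (etrans (addrC _ _) rp2).
  have [l [-> ->]] := kernel_line B20 (etrans (addrC _ _) rs2).
  transitivity (- (k * l * (c * (b ^+ 2 - a ^+ 2) * (q2 * r2)
                            + a * (a ^+ 2 - b ^+ 2) * (q1 * r1)))
                * (A1 * B2 - B1 * A2)); last by rewrite det mulr0.
  by rewrite /A1 /B1 /A2 /B2; ring.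
(* It remains to exclude M = 0. Its entries then give two symmetric linear systems: one in q2 r2, q1
   r1 of determinant a^2 - c^2, one in q1 r2, q2 r1 of determinant a^2 - b^2. *)
have eq0 (d u v : K) : d != 0 ->
    a * u + d * v = 0 -> a * v + d * u = 0 ->
    (a ^+ 2 != d ^+ 2 -> u = 0 /\ v = 0) /\ (u * v = 0 -> u = 0 /\ v = 0).
  move=> d0 uv vu; split=> [ad|/eqP].
    have u0 : (a ^+ 2 - d ^+ 2) * u = 0.
      transitivity (a * (a * u + d * v) - d * (a * v + d * u)); first by ring.
      by rewrite uv vu !mulr0 subr0.
    have v0 : (a ^+ 2 - d ^+ 2) * v = 0.
      transitivity (a * (a * v + d * u) - d * (a * u + d * v)); first by ring.
      by rewrite uv vu !mulr0 subr0.
    by move/eqP: u0; move/eqP: v0; rewrite !mulf_eq0 subr_eq0 (negPf ad) /=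
      => /eqP -> /eqP ->.
  rewrite mulf_eq0 => /orP[] /eqP z; move: uv vu; rewrite z !(mulr0, add0r, addr0).
    by move/eqP; rewrite mulf_eq0 (negPf d0) => /eqP ->.
  by move/eqP; rewrite mulf_eq0 (negPf a0) => /eqP ->.
have [XYs XYp] := eq0 c _ _ c0 A10 B20.
have [UVs UVp] := eq0 b _ _ b0 A20 B10.
have XUV : q2 * r2 * (q1 * r1) = q1 * r2 * (q2 * r1) by ring.
(* Since b^2 and c^2 differ, one of the systems is nondegenerate and kills its pair. Both pairs have
   the same product, so the other pair has product 0 and vanishes as well. *)
have [[Y0 X0] [U0 V0]] :
    (q2 * r2 = 0 /\ q1 * r1 = 0) /\ (q1 * r2 = 0 /\ q2 * r1 = 0).
  have [ab|/UVs UV] := eqVneq (a ^+ 2) (b ^+ 2).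
    by have /XYs XY : a ^+ 2 != c ^+ 2; rewrite ?ab //; split=> //; apply: UVp;
      rewrite -XUV; case: XY => -> ->; rewrite mulr0.
  by split=> //; apply: XYp; rewrite XUV; case: UV => -> ->; rewrite mulr0.
have qr0 (u : K) : u * r1 = 0 -> u * r2 = 0 -> u = 0.
  move=> /eqP ur1 /eqP ur2; apply/eqP; move: (n0 _ _ r0); apply: contraFT => u0.
  by move: ur1 ur2; rewrite !mulf_eq0 (negPf u0) /= => -> ->.
by case/eqP: q0; rewrite (qr0 q1) // (qr0 q2).
Qed.

End PointModule.

(** * Words, degrees and linear forms on the free algebra *)

Lemma mulr3_sumZ (K : fieldType) (A : algType K) (I J : Type)
    (s : seq I) (t : seq J) (f : I -> K) (g : J -> K) (x : I -> A) (y : J -> A)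
    (r : A) :
  (\sum_(i <- s) f i *: x i) * r * (\sum_(j <- t) g j *: y j) =
  \sum_(i <- s) \sum_(j <- t) (f i * g j) *: (x i * r * y j).
Proof.
rewrite !mulr_suml; apply: eq_bigr => i _; rewrite mulr_sumr.
by apply: eq_bigr => j _; rewrite -scalerAr -!scalerAl scalerA mulrC.
Qed.

Section FreeAlgebra.
Variable K : fieldType.
Implicit Types (u v r : freeAlg K) (s t : seq bool).

Definition word s : freeAlg K := mkmalgU (FMonom s) 1.

Lemma wordM s t : word s * word t = word (s ++ t).
Proof.
rewrite /word [LHS]malgM_def fgmulUU mulr1; congr mkmalgU; exact: fmmulE.
Qed.

Lemma word_nil : word [::] = 1.
Proof. by rewrite /word -fmoneE. Qed.

Lemma freeAlgE u : u = \sum_(w <- monalg.msupp u) monalg.mcoeff w u *: word w.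
Proof.
rewrite {1}[u]monalgE; apply: eq_bigr => w _; apply/malgP => w'.
by rewrite monalg.mcoeffZ !monalg.mcoeffU fmK mulr_natr.
Qed.

Lemma mulr3_wordE u r v :
  u * r * v = \sum_(s <- monalg.msupp u) \sum_(t <- monalg.msupp v)
    (monalg.mcoeff s u * monalg.mcoeff t v) *: (word s * r * word t).
Proof.
by etransitivity; last exact: mulr3_sumZ; rewrite -!freeAlgE.
Qed.

(** By bilinearity the ideal is spanned by the generators multiplied by words on both sides, so a
    linear map need only be tested there. *)
Lemma linear_two_sided_ideal_eq0 (V : lmodType K) (F : {linear freeAlg K -> V})
    (P : freeAlg K -> Prop) u :
    (forall r s t, P r -> F (word s * r * word t) = 0) ->
  two_sided_ideal P u -> F u = 0.
Proof.
move=> F0 [l Pl ->]; rewrite linear_sum big1_seq // => t /andP[_ /Pl Pt].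
rewrite mulr3_wordE linear_sum big1 // => v _; rewrite linear_sum big1 // => w _.
by rewrite linearZ /= F0 ?scaler0.
Qed.

Definition of_degree d u :=
  forall w : {fmonom bool}, w \in monalg.msupp u -> fdeg w = d.

Lemma of_degreeD d u v : of_degree d u -> of_degree d v -> of_degree d (u + v).
Proof.
move=> hu hv w /(fsubsetP (monalg.msuppD_le _ _)).
by rewrite in_fsetU => /orP[/hu|/hv].
Qed.

Lemma of_degreeZ d k u : of_degree d u -> of_degree d (k *: u).
Proof. by move=> hu w /(fsubsetP (monalg.msuppZ_le _ _)) /hu. Qed.

Lemma of_degreeM d e u v : of_degree d u -> of_degree e v -> of_degree (d + e) (u * v).
Proof.
move=> hu hv w /monalg.msuppM_le [w1 [w2 [/hu <- /hv <- ->]]].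
exact: fdegM.
Qed.

Lemma of_degree_word d s : size s = d -> of_degree d (word s).
Proof. by move=> <- w; rewrite /word monalg.msuppU1 inE => /eqP ->. Qed.

Definition hcomp d u : freeAlg K :=
  [malg w in monalg.msupp u => if fdeg w == d then monalg.mcoeff w u else 0].

Lemma mcoeff_hcomp d u w :
  monalg.mcoeff w (hcomp d u) = if fdeg w == d then monalg.mcoeff w u else 0.
Proof.
by rewrite mcoeffE; case: monalg.msuppP => //; case: ifP.
Qed.

Lemma hcomp_is_linear d : linear (hcomp d).
Proof.
move=> k u v; apply/malgP => w.
rewrite monalg.mcoeffD monalg.mcoeffZ !mcoeff_hcomp.
rewrite monalg.mcoeffD monalg.mcoeffZ.
by case: ifP => // _; rewrite mulr0 addr0.
Qed.
HB.instance Definition _ d :=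
  GRing.isLinear.Build K (freeAlg K) (freeAlg K) _ (hcomp d) (hcomp_is_linear d).

Lemma hcomp_of_degree d e u : of_degree e u -> hcomp d u = if e == d then u else 0.
Proof.
move=> hu; apply/malgP => w; rewrite mcoeff_hcomp.
case: (monalg.msuppP u w) => [wu|wNu].
  by rewrite (hu _ wu) (fun_if (monalg.mcoeff w)) monalg.mcoeff0.
rewrite if_same; case: ifP => _; rewrite ?monalg.mcoeff0 //.
by rewrite (monalg.mcoeff_outdom wNu).
Qed.

(** Multiplying by words raises the degree by their lengths, so only the empty words of [u] and [v]
    contribute in degree [d]. *)
Lemma hcomp_mulr3 d u r v :
  of_degree d r -> exists k, hcomp d (u * r * v) = k *: r.
Proof.
move=> hr; rewrite mulr3_wordE linear_sum.
have spanD w1 w2 : (exists k, w1 = k *: r) -> (exists k, w2 = k *: r) ->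
    exists k, w1 + w2 = k *: r.
  by move=> [k ->] [l ->]; exists (k + l); rewrite scalerDl.
apply: (big_ind (fun w => exists k, w = k *: r)) => [|w1 w2|s _];
  [by exists 0; rewrite scale0r | exact: spanD |].
rewrite linear_sum.
apply: (big_ind (fun w => exists k, w = k *: r)) => [|w1 w2|t _];
  [by exists 0; rewrite scale0r | exact: spanD |].
have hst := of_degreeM (of_degreeM (of_degree_word (erefl (size s))) hr)
  (of_degree_word (erefl (size t))).
rewrite linearZ /= (hcomp_of_degree _ hst).
case: eqP => [|_]; last by exists 0; rewrite scale0r scaler0.
rewrite addnAC -[RHS]add0n => /addIn /eqP.
rewrite addn_eq0 => /andP[/nilP -> /nilP ->].
rewrite word_nil mul1r mulr1; eexists; reflexivity.
Qed.

Definition word_functional (h : seq bool -> K) (u : freeAlg K) : K^o :=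
  monalg.mmap idfun (fun w : {fmonom bool} => h w) u.

Lemma word_functional_is_linear h : linear (word_functional h).
Proof.
move=> k u v; rewrite /word_functional raddfD /=; congr (_ + _).
rewrite (monalg.mmapEw (monalg.msuppZ_le _ _)) monalg.mmapE scaler_sumr.
apply: eq_bigr => w _.
by rewrite /= monalg.mcoeffZ -mulrA.
Qed.
HB.instance Definition _ h := GRing.isLinear.Build K (freeAlg K) K^o _
  (word_functional h) (word_functional_is_linear h).

Lemma word_functional_word h s : word_functional h (word s) = h s.
Proof. by rewrite /word_functional monalg.mmapU mul1r. Qed.

End FreeAlgebra.

(** * The explicit quartic element: symmetries, degree and nonvanishing *)

Section Quartic.
Variables (K : fieldType) (a b c : K).

(** A noncommutative polynomial evaluated in any algebra, so that one formula serves the free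
    algebra and its quotient, and automorphisms act by substitution. *)
Definition quartic (A : algType K) (x y : A) : A :=
  (c * (b ^+ 2 - a ^+ 2)) *: (x * x * x * x + y * y * y * y)
  + (a * (a ^+ 2 - c ^+ 2)) *: (x * x * y * y + y * y * x * x)
  + (b * (c ^+ 2 - a ^+ 2)) *: (x * y * x * y + y * x * y * x)
  + (a * (a ^+ 2 - b ^+ 2)) *: (x * y * y * x + y * x * x * y).

Lemma quarticC (A : algType K) (x y : A) : quartic x y = quartic y x.
Proof.
by rewrite /quartic; congr (_ *: _ + _ *: _ + _ *: _ + _ *: _); exact: addrC.
Qed.

Lemma quarticN (A : algType K) (x y : A) : quartic x (- y) = quartic x y.
Proof. by rewrite /quartic !(mulrN, mulNr, opprK). Qed.

Lemma rmorph_quartic (A B : algType K) (f : {lrmorphism A -> B}) (x y : A) :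
  f (quartic x y) = quartic (f x) (f y).
Proof. by rewrite {1}/quartic !(linearD, linearZ) /= !rmorphM. Qed.

Local Notation S := (sklyanin a b c).
Local Notation x := (skx a b c).
Local Notation y := (sky a b c).
Local Notation X := (word K [:: false]).
Local Notation Y := (word K [:: true]).

Lemma sklyanin_pi_word :
  sklyanin_pi a b c X = x /\ sklyanin_pi a b c Y = y.
Proof. by rewrite /word -!fmuE. Qed.

Lemma sklyanin_pi_quartic : sklyanin_pi a b c (quartic X Y) = quartic x y.
Proof. by rewrite rmorph_quartic /=; have [-> ->] := sklyanin_pi_word. Qed.

Lemma quartic_wordE (A : algType K) (w : seq bool -> A) :
    (forall s t, w s * w t = w (s ++ t)) ->
  quartic (w [:: false]) (w [:: true]) =
  (c * (b ^+ 2 - a ^+ 2)) *: (w [:: false; false; false; false]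
                              + w [:: true; true; true; true])
  + (a * (a ^+ 2 - c ^+ 2)) *: (w [:: false; false; true; true]
                                + w [:: true; true; false; false])
  + (b * (c ^+ 2 - a ^+ 2)) *: (w [:: false; true; false; true]
                                + w [:: true; false; true; false])
  + (a * (a ^+ 2 - b ^+ 2)) *: (w [:: false; true; true; false]
                                + w [:: true; false; false; true]).
Proof. by move=> wM; rewrite /quartic !wM. Qed.

Lemma cubic_rel_wordE (A : algType K) (w : seq bool -> A) (i j : bool) :
    (forall s t, w s * w t = w (s ++ t)) ->
  cubic_rel a b c (w [:: i]) (w [:: j]) =
  a *: (w [:: j; j; i] + w [:: i; j; j])
  + b *: w [:: j; i; j] + c *: w [:: i; i; i].
Proof. by move=> wM; rewrite /cubic_rel !exprS !expr0 !mulr1 !wM. Qed.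

Lemma linear_cubic_rel_wordE (A : algType K) (V : lmodType K)
    (F : {linear A -> V}) (w : seq bool -> A) (h : seq bool -> V)
    (i j : bool) (s t : seq bool) :
    (forall s t, w s * w t = w (s ++ t)) -> (forall s, F (w s) = h s) ->
  F (w s * cubic_rel a b c (w [:: i]) (w [:: j]) * w t) =
  a *: (h (s ++ [:: j, j, i & t]) + h (s ++ [:: i, j, j & t]))
  + b *: h (s ++ [:: j, i, j & t]) + c *: h (s ++ [:: i, i, i & t]).
Proof.
move=> wM Fw; rewrite (cubic_rel_wordE _ _ wM) !mulrDr !mulrDl -!scalerAr.
by rewrite -!scalerAl mulrDr mulrDl !wM -!catA !(linearD, linearZ) /= !Fw ?scalerDr.
Qed.

Lemma linear_quartic_wordE (A : algType K) (V : lmodType K)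
    (F : {linear A -> V}) (w : seq bool -> A) (h : seq bool -> V) :
    (forall s t, w s * w t = w (s ++ t)) -> (forall s, F (w s) = h s) ->
  F (quartic (w [:: false]) (w [:: true])) =
  (c * (b ^+ 2 - a ^+ 2)) *: (h [:: false; false; false; false]
                              + h [:: true; true; true; true])
  + (a * (a ^+ 2 - c ^+ 2)) *: (h [:: false; false; true; true]
                                + h [:: true; true; false; false])
  + (b * (c ^+ 2 - a ^+ 2)) *: (h [:: false; true; false; true]
                                + h [:: true; false; true; false])
  + (a * (a ^+ 2 - b ^+ 2)) *: (h [:: false; true; true; false]
                                + h [:: true; false; false; true]).
Proof.
by move=> wM Fw; rewrite (quartic_wordE wM) !(linearD, linearZ) /= !Fw ?scalerDr.
Qed.

Lemma of_degree_quartic : of_degree 4 (quartic X Y).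
Proof.
rewrite (quartic_wordE (@wordM K)).
by do 3![apply: of_degreeD; last by apply: of_degreeZ; apply: of_degreeD;
           apply: of_degree_word];
  apply: of_degreeZ; apply: of_degreeD; apply: of_degree_word.
Qed.

Lemma sklyanin_homog_quartic : sklyanin_homog 4 (quartic x y).
Proof.
by exists (quartic X Y); [exact: of_degree_quartic | rewrite sklyanin_pi_quartic].
Qed.

Lemma of_degree_cubic_rel (i j : bool) :
  of_degree 3 (cubic_rel a b c (word K [:: i]) (word K [:: j])).
Proof.
rewrite (cubic_rel_wordE _ _ (@wordM K)).
by do 2![apply: of_degreeD; last by apply: of_degreeZ; apply: of_degree_word];
  apply: of_degreeZ; apply: of_degreeD; apply: of_degree_word.
Qed.

(** The ideal of relations is graded: products of words with the relations, which have degree 3, are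
    homogeneous, so [hcomp d] either keeps or kills each of them. *)
Lemma sklyanin_pi_hcomp d u :
  sklyanin_pi a b c u = 0 -> sklyanin_pi a b c (hcomp d u) = 0.
Proof.
move/sklyanin_pi_eq0.
pose F : {linear freeAlg K -> S} := sklyanin_pi a b c \o hcomp d.
have -> : sklyanin_pi a b c (hcomp d u) = F u by [].
apply: linear_two_sided_ideal_eq0 => r s t rel; rewrite /F /=.
have [hr r0] : of_degree 3 r /\ sklyanin_pi a b c r = 0.
  split; last exact/sklyanin_pi_eq0/two_sided_ideal_gen.
  by case: rel => ->; rewrite !fmuE; apply: of_degree_cubic_rel.
rewrite (hcomp_of_degree _
  (of_degreeM (of_degreeM (of_degree_word (erefl (size s))) hr)
    (of_degree_word (erefl (size t))))).
by case: eqP => _; rewrite ?raddf0 // !rmorphM /= r0 mulr0 mul0r.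
Qed.

(** Lift an expression of [v] as a sum of s u t to the free algebra and take degree [d] components:
    each summand contributes a multiple of the lift of [u]. *)
Lemma principal_ideal_homog d (u v : S) :
    sklyanin_homog d u -> sklyanin_homog d v ->
  two_sided_ideal (fun r => r = u) v -> exists k, v = k *: u.
Proof.
move=> [u' hu ->] [v' hv ->] [l lu Ev].
have lin (s t : S) : exists k,
    exists2 w, sklyanin_pi a b c w = s * sklyanin_pi a b c u' * t
             & hcomp d w = k *: u'.
  have [s' ->] := sklyanin_pi_surj s; have [t' ->] := sklyanin_pi_surj t.
  have [k Ek] := hcomp_mulr3 s' t' hu.
  by exists k, (s' * u' * t'); rewrite ?rmorphM.
have [k [w Ew Ek]] : exists k, exists2 w,
    sklyanin_pi a b c w = \sum_(t <- l) t.1.1 * t.1.2 * t.2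
    & hcomp d w = k *: u'.
  elim: l lu {Ev} => [_|t l IHl lu].
    by exists 0, 0; rewrite ?big_nil ?raddf0 ?scale0r.
  have [|k1 [w1 E1 h1]] := IHl; first by move=> z zl; apply: lu; rewrite inE zl orbT.
  have [k2 [w2 E2 h2]] := lin t.1.1 t.2.
  exists (k2 + k1), (w2 + w1); last by rewrite raddfD /= h1 h2 scalerDl.
  by rewrite big_cons raddfD /= E1 E2 (lu t) // inE eqxx.
(* The two lifts of [v] differ by an element of the graded ideal, so their degree [d] components
   also agree in the quotient. *)
exists k; have /sklyanin_pi_hcomp-/(_ d) : sklyanin_pi a b c (v' - w) = 0.
  by rewrite raddfB /= Ew Ev subrr.
rewrite !raddfB /= (hcomp_of_degree _ hv) eqxx Ek linearZ => /eqP.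
by rewrite subr_eq0 => /eqP.
Qed.

(* The values that functionals invariant under [H2] and vanishing on the
   relations of degree 4 may take on the four types of words. *)
Definition quartic_functional (l m : K) (s : seq bool) : K :=
  match s with
  | [:: i; j; k; n] =>
    if i (+) j (+) k (+) n then 0
    else if i == j then if j == k then l * a else m * b
    else if i == k then - (m * a) else - (l * c)
  | _ => 0
  end.

Lemma quartic_functional_relE l m (i : bool) (s t : seq bool) :
  let h := quartic_functional l m in
  a * (h (s ++ [:: ~~ i, ~~ i, i & t]) + h (s ++ [:: i, ~~ i, ~~ i & t]))
  + b * h (s ++ [:: ~~ i, i, ~~ i & t]) + c * h (s ++ [:: i, i, i & t]) = 0.
Proof.
(* All four words have length |s| + |t| + 3; unless |s| + |t| = 1 every value is the default 0, and
   otherwise finitely many letters are checked. *)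
case: s => [|i1 [|i2 [|i3 [|i4 [|i5 s]]]]]; case: t => [|j1 [|j2 t]] /=;
  try case: i; try case: i1; try case: j1; rewrite /=; ring.
Qed.

Lemma quartic_functional_rel l m (i : bool) (s t : seq bool) :
  word_functional (quartic_functional l m)
    (word K s * cubic_rel a b c (word K [:: i]) (word K [:: ~~ i]) * word K t) = 0.
Proof.
rewrite (linear_cubic_rel_wordE _ _ _ _ (@wordM K) (word_functional_word _)).
exact: quartic_functional_relE.
Qed.

(** The parameters [l] and [m] detect a^2 - b^2 and a^2 - c^2 separately. *)
Lemma quartic_functional_quarticE l m :
  let h := quartic_functional l m in
  (c * (b ^+ 2 - a ^+ 2)) * (h [:: false; false; false; false]
                             + h [:: true; true; true; true])
  + (a * (a ^+ 2 - c ^+ 2)) * (h [:: false; false; true; true]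
                               + h [:: true; true; false; false])
  + (b * (c ^+ 2 - a ^+ 2)) * (h [:: false; true; false; true]
                               + h [:: true; false; true; false])
  + (a * (a ^+ 2 - b ^+ 2)) * (h [:: false; true; true; false]
                               + h [:: true; false; false; true])
  = 2 * 2 * a * (m * b * (a ^+ 2 - c ^+ 2) - l * c * (a ^+ 2 - b ^+ 2)).
Proof. by rewrite /=; ring. Qed.

Lemma quartic_neq0 : 2 != 0 :> K -> a != 0 -> b != 0 -> c != 0 ->
  b ^+ 2 != c ^+ 2 -> quartic x y != 0.
Proof.
move=> two0 a0 b0 c0 bc; apply/eqP => g0.
have {g0} F0 l m : word_functional (quartic_functional l m) (quartic X Y) = 0.
  move: g0; rewrite -sklyanin_pi_quartic => /sklyanin_pi_eq0.
  apply: linear_two_sided_ideal_eq0 => r s t.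
  by case=> ->; rewrite !fmuE; [apply: (@quartic_functional_rel _ _ false)
                               | apply: (@quartic_functional_rel _ _ true)].
have F l m : 2 * 2 * a * (m * b * (a ^+ 2 - c ^+ 2) - l * c * (a ^+ 2 - b ^+ 2)) = 0.
  rewrite -quartic_functional_quarticE -[RHS](F0 l m); apply: esym.
  exact: (linear_quartic_wordE (@wordM K) (word_functional_word _)).
(* These two choices give a^2 = c^2 and a^2 = b^2, against [bc]. *)
have := F 0 1; have := F 1 0.
rewrite !(mul0r, mul1r, subr0, sub0r) => /eqP + /eqP.
rewrite !mulf_eq0 oppr_eq0 !mulf_eq0 (negPf two0) (negPf a0) (negPf b0) (negPf c0) /=.
rewrite !subr_eq0 => /eqP ab /eqP ac.
by rewrite -ab -ac eqxx in bc.
Qed.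

End Quartic.

(** * The quartic element annihilates the point modules *)

Section PointModules.
Variables (K : fieldType) (a b c : K).
Local Notation S := (sklyanin a b c).
Local Notation x := (skx a b c).
Local Notation y := (sky a b c).

Section Action.
Variables (A : algType K) (V : lmodType K) (act : V -> A -> V).
Hypothesis actP : right_module act.

Lemma act_linear v : exists f : {linear A -> V}, act v =1 f.
Proof.
have [_ lin _ _] := actP.
pose f : {linear A -> V} :=
  HB.pack (act v) (GRing.isLinear.Build K A V _ (act v) (lin v)).
by exists f.
Qed.

Lemma act_linearl s : exists f : {linear V -> V}, act^~ s =1 f.
Proof.
have [lin _ _ _] := actP.
pose f : {linear V -> V} :=
  HB.pack (act^~ s) (GRing.isLinear.Build K V V _ (act^~ s) (lin s)).
by exists f.
Qed.

Lemma actD v s t : act v (s + t) = act v s + act v t.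
Proof. by have [f fE] := act_linear v; rewrite !fE linearD. Qed.

Lemma actZ v k s : act v (k *: s) = k *: act v s.
Proof. by have [f fE] := act_linear v; rewrite !fE linearZ. Qed.

Lemma actZl k v s : act (k *: v) s = k *: act v s.
Proof.
by have [f fE] := act_linearl s; have := fE; rewrite /= => E; rewrite !E linearZ.
Qed.

Lemma act_suml I (r : seq I) (F : I -> V) s :
  act (\sum_(i <- r) F i) s = \sum_(i <- r) act (F i) s.
Proof.
have [f fE] := act_linearl s; have := fE; rewrite /= => E.
by rewrite E linear_sum; apply: eq_bigr => i _.
Qed.

(** In a right module the letters of a word act from left to right, so the j-th letter, counted from
    0, meets the coordinates [p (i + j)]. *)
Lemma act_quartic (x y : A) (e : nat -> V) (p : nat -> K * K) i :
    (forall j, act (e j) x = (p j).1 *: e j.+1) ->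
    (forall j, act (e j) y = (p j).2 *: e j.+1) ->
  act (e i) (quartic a b c x y) =
  quartic_form a b c (p i) (p i.+1) (p i.+2) (p i.+3) *: e (i.+4).
Proof.
have [_ _ _ actM] := actP => act_x act_y.
rewrite /quartic !(actD, actZ, actM) !(act_x, act_y, actZl, scalerA).
by rewrite -!scalerDl !scalerA -!scalerDl.
Qed.

End Action.

Lemma quartic_annihilates :
    a != 0 -> b != 0 -> c != 0 -> b ^+ 2 != c ^+ 2 ->
  annihilates_point_modules (quartic a b c x y).
Proof.
move=> a0 b0 c0 bc p act [_ p0 prel] pm v; have [actP actX] := pm.
rewrite -[v]coefK poly_def (act_suml actP) big1 // => i _.
have -> := actZl actP (v`_i) 'X^i (quartic a b c x y).
have -> := act_quartic actP (e := fun n => 'X^n) i (fun j => proj1 (actX j))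
  (fun j => proj2 (actX j)).
rewrite quartic_form_eq0 ?scale0r ?scaler0 //.
- by have [] := prel i.
- by have [] := prel i.
- by have [] := prel i.+1.
- by have [] := prel i.+1.
Qed.

End PointModules.

(** * Invariant vectors and the trivial representation *)

Section TrivialRep.
Variables (K : fieldType) (a b c : K).
Local Notation S := (sklyanin a b c).

(** The elements fixing [s] contain 1 and are closed under products, hence form a subgroup as [H] is
    finite; it contains both generators. *)
Lemma rho_fixed_gen (H : finGroupType) (e1 e2 : H)
    (rho : H -> {lrmorphism S -> S}) (s : S) :
    [set: H] = <<[set e1; e2]>>%g ->
    (forall t, rho 1%g t = t) ->
    (forall g h t, rho (g * h)%g t = rho g (rho h t)) ->
    rho e1 s = s -> rho e2 s = s ->
  forall g, rho g s = s.
Proof.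
move=> gen rho1 rhoM r1 r2 g.
have Fgroup : group_set [set h | rho h s == s].
  apply/group_setP; split=> [|h1 h2]; rewrite !in_set.
    by apply/eqP; apply: rho1.
  move=> /eqP h1s /eqP h2s; apply/eqP.
  by apply: etrans h1s; rewrite -[in RHS]h2s; apply: rhoM.
have sub : [set e1; e2] \subset Group Fgroup.
  by apply/subsetP => h /set2P[] ->; rewrite in_set; apply/eqP.
move: sub; rewrite -gen_subG -gen => /subsetP /(_ g).
by rewrite !in_set => /(_ isT) /eqP.
Qed.

Definition line (V : lmodType K) (u : V) (k : K^o) : V := (k : K) *: u.

Lemma line_is_linear (V : lmodType K) (u : V) : linear (line u).
Proof. by move=> k l m; rewrite /line scalerDl -scalerA. Qed.
HB.instance Definition _ (V : lmodType K) (u : V) :=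
  GRing.isLinear.Build K K^o V _ (line u) (line_is_linear u).

Lemma line_is_trivial_rep_fixed (H : finGroupType)
    (rho : H -> {lrmorphism S -> S}) (u : S) :
  u != 0 -> (forall g, rho g u = u) -> line_is_trivial_rep rho u.
Proof.
move=> u0 fix_u; exists (line u); split=> [k l /eqP| s | g k].
- by rewrite -subr_eq0 -scalerBl scaler_eq0 (negPf u0) orbF subr_eq0 => /eqP.
- by split=> -[k ->]; exists k.
- by rewrite /= /line linearZ /= fix_u.
Qed.

End TrivialRep.

Theorem mainTheorem6 (R : realType) (a b c : R[i])
    (H2 : finGroupType) (e1 e2 : H2)
    (rho : H2 -> {lrmorphism sklyanin a b c -> sklyanin a b c})
    (c2 : sklyanin a b c) :
  cubic_sklyanin a b c ->
  heisenberg2 e1 e2 ->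
  heisenberg_action e1 e2 rho ->
  point_annihilator_generator c2 ->
  line_is_trivial_rep rho c2.
Proof.
move=> [_ [_ smooth _]] [gen _ _ _] [rho1 rhoM _ [e1x e1y] [e2x e2y]].
move=> [c2_neq0 c2_homog _ annE].
have [a0 b0 c0 bc] := smooth_E_form_coefs smooth.
(* The annihilator is generated by [c2], which has the same degree 4 as the quartic element. *)
have [k gk] : exists k, quartic a b c (skx a b c) (sky a b c) = k *: c2.
  apply: (principal_ideal_homog c2_homog); first exact: sklyanin_homog_quartic.
  by apply/annE; apply: quartic_annihilates.
have k0 : k != 0.
  apply/eqP => k0; move: gk; rewrite k0 scale0r => /eqP.
  by apply/negP/quartic_neq0; rewrite ?pnatr_eq0.
have c2E := canRL (scalerK k0) (esym gk).
apply: (line_is_trivial_rep_fixed c2_neq0).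
(* As [c2] is a scalar multiple of the quartic element, invariance reduces to the swap of the
   generators by [e1] and the sign change by [e2]. *)
apply: (rho_fixed_gen gen rho1 rhoM); rewrite c2E linearZ /= rmorph_quartic.
  by rewrite e1x e1y quarticC.
by rewrite e2x e2y quarticN.
Qed.
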